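(* For an integer $x$ let $$A_2(x)=\begin{pmatrix} x & x+1 \\ {x+2} & x+3 \end{pmatrix},\qquad A_2'(x)=\begin{pmatrix} x+3 & x+1 \\ {x+2} & x \end{pmatrix},$$ and for $r>1$ define recursively the $2^r\times 2^r$ arrays $$A_{2^r}(x)=\begin{pmatrix} I_{2^{r-1}}(x) & A_{2^{r-1}}(x+2) \\ {A'_{2^{r-1}}(x+2)} & I_{2^{r-1}}(x+1) \end{pmatrix},\qquad A'_{2^r}(x)=\begin{pmatrix} I_{2^{r-1}}(x+1) & A_{2^{r-1}}(x+2) \\ {A'_{2^{r-1}}(x+2)} & I_{2^{r-1}}(x) \end{pmatrix}.$$ Let $\mathcal{S}$ be the set of integers occurring in $A_{2^r}(x)$ and $A'_{2^r}(x)$. Then for every $r\ge 1$ and every integer $t\notin\mathcal{S}$, $\mathcal{A}=\{A_{2^r}(x),A'_{2^r}(x)\}$ is a set of two PDAs that are Blackburn-compatible w.r.t. $I_{2^r}(t)$, and the lifting $L_{\mathcal{A},I_{2^r}}(I_2)$ is a $2^r$-regular $(2^{r+1},\;2^{r+1},\;2^{r+1}-r-2,\;2r+4)$ PDA.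
   Context: Notation: $[n]=\{0,1,\dots,n-1\}$. For positive integers $K,f$, a nonnegative integer $Z$ and a finite set $\mathcal{S}$ of integers, a $(K,f,Z,\mathcal{S})$ placement delivery array (PDA) is an $f\times K$ array $P=[p_{j,k}]$ with entries in $\mathcal{S}\cup\{\ast\}$ such that: (C1) $\ast$ appears exactly $Z$ times in each column; (C2) each $s\in\mathcal{S}$ occurs at least once; (C3, Blackburn property) if two distinct cells $(j_1,k_1)$, $(j_2,k_2)$ contain the same integer then $p_{j_1,k_2}=p_{j_2,k_1}=\ast$. It is $g$-regular if each integer of $\mathcal{S}$ occurs exactly $g$ times. A number $S$ in place of the set means the integer set has $S$ elements. Blackburn compatibility: for arrays $P_0,P_1,P_\ast$ of the same size, $P_0$ and $P_1$ are Blackburn-compatible w.r.t. $P_\ast$ if, whenever $p^{(0)}_{i_1j_1}=p^{(1)}_{i_2j_2}\neq\ast$, we have $p^{(\ast)}_{i_1j_2}=p^{(\ast)}_{i_2j_1}=\ast$. $I_n(t)$ is the $n\times n$ array with integer $t$ on the main diagonal and $\ast$ elsewhere. $L_{\mathcal{A},I_{2^r}}(I_2)=\begin{pmatrix} A_{2^r}(x) & I_{2^r}(t_1) \\ {I_{2^r}(t_2)} & A'_{2^r}(x) \end{pmatrix}$ with $t_1\ne t_2$ integers not in $\mathcal{S}$. *)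

(* Defs.v *)
From mathcomp Require Import all_boot all_order all_algebra finmap.

Set Implicit Arguments.
Unset Strict Implicit.
Unset Printing Implicit Defensive.

Import GRing.Theory.
Local Open Scope ring_scope.

(* Arrays have entries in [option int]; the symbol * is [None]. *)
Notation array f K := 'M[option int]_(f, K).

Definition entries f K (P : array f K) : {fset int} :=
  [fset s in pmap (fun c : 'I_f * 'I_K => P c.1 c.2) (enum {: 'I_f * 'I_K})]%fset.

Definition blackburn f K (P : array f K) : Prop :=
  forall (j1 j2 : 'I_f) (k1 k2 : 'I_K) (s : int),
    (j1, k1) <> (j2, k2) -> P j1 k1 = Some s -> P j2 k2 = Some s ->
    P j1 k2 = None /\ P j2 k1 = None.

(* K columns, f rows, Z stars in each column, integer set S. *)
Definition pda (K f Z : nat) (S : {fset int}) (P : array f K) : Prop :=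
  [/\ (0 < K)%N /\ (0 < f)%N,
      forall j k s, P j k = Some s -> s \in S,
      forall k, #|[set j | P j k == None]| = Z,
      forall s, s \in S -> exists j k, P j k = Some s
    & blackburn P].

Definition is_pda (K f : nat) (P : array f K) : Prop :=
  exists (Z : nat) (S : {fset int}), pda Z S P.

Definition regular (g f K : nat) (S : {fset int}) (P : array f K) : Prop :=
  forall s, s \in S ->
    #|[set c : 'I_f * 'I_K | P c.1 c.2 == Some s]| = g.

(* g-regular (K, f, Z, n) PDA, where the number n is the size of the set of
   integers. *)
Definition regular_pda (g K f Z n : nat) (P : array f K) : Prop :=
  exists S : {fset int}, [/\ #|` S| = n, pda Z S P & regular g S P].
Arguments regular_pda : clear implicits.

Definition blackburn_compatible f K (P0 P1 Pstar : array f K) : Prop :=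
  forall (i1 i2 : 'I_f) (j1 j2 : 'I_K) (s : int),
    P0 i1 j1 = Some s -> P1 i2 j2 = Some s ->
    Pstar i1 j2 = None /\ Pstar i2 j1 = None.

Definition diag_array (n : nat) (t : int) : array n n :=
  \matrix_(i, j) if i == j then Some t else None.

Lemma expn2_double (r : nat) : (2 ^ r + 2 ^ r = 2 ^ r.+1)%N.
Proof. by rewrite addnn expnS mul2n. Qed.

(* [block_mx], cast from size 2^r + 2^r to size 2^(r+1). *)
Definition block_array (r : nat) (Aul Aur Adl Adr : array (2 ^ r) (2 ^ r)) :
    array (2 ^ r.+1) (2 ^ r.+1) :=
  castmx (expn2_double r, expn2_double r) (block_mx Aul Aur Adl Adr).

(* [arrA r x] and [arrA' r x] are the arrays A_{2^r}(x) and A'_{2^r}(x),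
   r >= 1; the value at r = 0 is a dummy. For r = 1 (r' = 0) the four blocks
   have size 2^0 = 1. *)
Fixpoint arrA (r : nat) (x : int) {struct r} : array (2 ^ r) (2 ^ r) :=
  match r with
  | 0 => const_mx None
  | r'.+1 =>
    if r' == 0%N then
      block_array (const_mx (Some x)) (const_mx (Some (x + 1)))
                  (const_mx (Some (x + 2))) (const_mx (Some (x + 3)))
    else
      block_array (diag_array (2 ^ r') x) (arrA r' (x + 2))
                  (arrA' r' (x + 2)) (diag_array (2 ^ r') (x + 1))
  end
with arrA' (r : nat) (x : int) {struct r} : array (2 ^ r) (2 ^ r) :=
  match r with
  | 0 => const_mx None
  | r'.+1 =>
    if r' == 0%N then
      block_array (const_mx (Some (x + 3))) (const_mx (Some (x + 1)))
                  (const_mx (Some (x + 2))) (const_mx (Some x))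
    else
      block_array (diag_array (2 ^ r') (x + 1)) (arrA r' (x + 2))
                  (arrA' r' (x + 2)) (diag_array (2 ^ r') x)
  end.

(* The lifting L_{A, I_{2^r}}(I_2) for A = {A0, A1}. *)
Definition lifting_I2 (r : nat) (A0 A1 : array (2 ^ r) (2 ^ r)) (t1 t2 : int) :
    array (2 ^ r.+1) (2 ^ r.+1) :=
  block_array A0 (diag_array (2 ^ r) t1) (diag_array (2 ^ r) t2) A1.

(* Main.v *)
(** Both the recursion and the lifting place two arrays sharing integers in
    opposite corners of a 2 x 2 block array whose other two blocks are diagonal
    arrays with fresh integers. Compatibility with respect to a diagonal array
    says exactly that the cross cells of equal entries of the two arrays fall
    off the diagonal, that is, on stars. So everything follows by induction once
    one carries along, for the pair (A, A'), the number of stars per column and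
    the total number of occurrences of each integer in A and A' together. *)

Require Import Defs.
From mathcomp Require Import all_boot all_order all_algebra finmap zify.

Set Implicit Arguments.
Unset Strict Implicit.
Unset Printing Implicit Defensive.

Local Open Scope ring_scope.

(** * Counting integers and stars in block and diagonal arrays *)

(** A double sum of booleans instead of a cardinal, so that [big_split_ord] splits it along
    blocks. *)
Definition occurrences f K (P : array f K) (s : int) : nat :=
  (\sum_i \sum_j (P i j == Some s))%N.

Lemma card_occurrences f K (P : array f K) s :
  #|[set c : 'I_f * 'I_K | P c.1 c.2 == Some s]| = occurrences P s.
Proof.
rewrite /occurrences pair_big /= -sum1_card big_mkcond /=.
by apply: eq_bigr => c _; rewrite inE; case: (_ == _).
Qed.

Lemma occurrences_gt0P f K (P : array f K) s :
  reflect (exists j k, P j k = Some s) (0 < occurrences P s)%N.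
Proof.
rewrite -card_occurrences; apply: (iffP card_gt0P).
  by move=> [[j k]]; rewrite inE => /eqP; exists j, k.
by move=> [j [k Pjk]]; exists (j, k); rewrite inE Pjk.
Qed.

Lemma occurrences_block m (P00 P01 P10 P11 : array m m) s :
  occurrences (block_mx P00 P01 P10 P11) s =
  (occurrences P00 s + occurrences P01 s
   + (occurrences P10 s + occurrences P11 s))%N.
Proof.
rewrite /occurrences big_split_ord /=.
rewrite -[X in _ = (X + _)%N]big_split -[X in _ = (_ + X)%N]big_split /=.
apply: f_equal2; apply: eq_bigr => i _; rewrite big_split_ord /=;
  by apply: f_equal2; apply: eq_bigr => j _;
    rewrite ?block_mxEul ?block_mxEur ?block_mxEdl ?block_mxEdr.
Qed.

Lemma occurrences_diag n t s :
  occurrences (diag_array n t) s = (n * (s == t))%N.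
Proof.
rewrite /occurrences -[n in RHS]card_ord -sum_nat_const; apply: eq_bigr => i _.
rewrite (bigD1 i) //= big1 ?addn0 => [|j neq_ji]; rewrite mxE.
  by rewrite eqxx eq_sym.
by rewrite [i == j]eq_sym (negbTE neq_ji).
Qed.

Definition column_stars f K (P : array f K) (k : 'I_K) : nat :=
  (\sum_j (P j k == None))%N.

Lemma card_column_stars f K (P : array f K) k :
  #|[set j | P j k == None]| = column_stars P k.
Proof.
rewrite /column_stars -sum1_card big_mkcond /=.
by apply: eq_bigr => j _; rewrite inE; case: (_ == _).
Qed.

Lemma column_stars_diag n t k : column_stars (diag_array n t) k = n.-1.
Proof.
rewrite -[n in RHS]card_ord -(cardC1 k) -card_column_stars.
by apply: eq_card => j; rewrite !inE mxE; case: (j == k).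
Qed.

Lemma column_stars_block m (P00 P01 P10 P11 : array m m) z :
  (forall k, column_stars P00 k + column_stars P10 k = z)%N ->
  (forall k, column_stars P01 k + column_stars P11 k = z)%N ->
  forall k, column_stars (block_mx P00 P01 P10 P11) k = z.
Proof.
move=> zl zr k; rewrite /column_stars big_split_ord /=.
rewrite -(splitK k); case: (split k) => j /=.
  rewrite -(zl j); apply: f_equal2; apply: eq_bigr => i _;
  by rewrite ?block_mxEul ?block_mxEdl.
rewrite -(zr j); apply: f_equal2; apply: eq_bigr => i _;
by rewrite ?block_mxEur ?block_mxEdr.
Qed.

(** * The Blackburn property of block arrays *)

Definition disjoint_entries f K (P Q : array f K) : Prop :=
  forall i1 j1 i2 j2 s, P i1 j1 = Some s -> Q i2 j2 = Some s -> False.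

Lemma disjoint_entries_sym f K (P Q : array f K) :
  disjoint_entries P Q -> disjoint_entries Q P.
Proof. by move=> dPQ i1 j1 i2 j2 s eQ eP; apply: dPQ eP eQ. Qed.

(** Two cells with the same integer lie in one block, in adjacent blocks (excluded by disjointness),
    or in opposite blocks; in the last case the cross cells lie in the two remaining blocks. *)
Lemma blackburn_block m (P00 P01 P10 P11 : array m m) :
  blackburn P00 -> blackburn P01 -> blackburn P10 -> blackburn P11 ->
  (forall i1 j1 i2 j2 s, P00 i1 j1 = Some s -> P11 i2 j2 = Some s ->
    P01 i1 j2 = None /\ P10 i2 j1 = None) ->
  (forall i1 j1 i2 j2 s, P01 i1 j1 = Some s -> P10 i2 j2 = Some s ->
    P00 i1 j2 = None /\ P11 i2 j1 = None) ->
  disjoint_entries P00 P01 -> disjoint_entries P00 P10 ->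
  disjoint_entries P11 P01 -> disjoint_entries P11 P10 ->
  blackburn (block_mx P00 P01 P10 P11).
Proof.
move=> b00 b01 b10 b11 cd ca d1 d2 d3 d4 i1 i2 j1 j2 s.
rewrite -(splitK i1) -(splitK i2) -(splitK j1) -(splitK j2).
case: (split i1) => {}i1; case: (split j1) => {}j1;
case: (split i2) => {}i2; case: (split j2) => {}j2 /= neq;
rewrite ?block_mxEul ?block_mxEur ?block_mxEdl ?block_mxEdr => e1 e2;
try (by [case: (d1 _ _ _ _ _ e1 e2)|case: (d1 _ _ _ _ _ e2 e1)
    |case: (d2 _ _ _ _ _ e1 e2)|case: (d2 _ _ _ _ _ e2 e1)
    |case: (d3 _ _ _ _ _ e1 e2)|case: (d3 _ _ _ _ _ e2 e1)
    |case: (d4 _ _ _ _ _ e1 e2)|case: (d4 _ _ _ _ _ e2 e1)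
    |case: (cd _ _ _ _ _ e1 e2)|case: (cd _ _ _ _ _ e2 e1)
    |case: (ca _ _ _ _ _ e1 e2)|case: (ca _ _ _ _ _ e2 e1)]).
- by apply: b00 e1 e2 => -[? ?]; apply: neq; congr (lshift _ _, lshift _ _).
- by apply: b01 e1 e2 => -[? ?]; apply: neq; congr (lshift _ _, rshift _ _).
- by apply: b10 e1 e2 => -[? ?]; apply: neq; congr (rshift _ _, lshift _ _).
- by apply: b11 e1 e2 => -[? ?]; apply: neq; congr (rshift _ _, rshift _ _).
Qed.

(** * Diagonal arrays and pairs of arrays compatible with them *)

Lemma diag_arrayP n t i j s :
  diag_array n t i j = Some s -> i = j /\ s = t.
Proof. by rewrite mxE; case: eqP => // -> [->]. Qed.

Lemma diag_array_None n t i j : diag_array n t i j = None <-> i <> j.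
Proof. by rewrite mxE; case: eqP => [->|neq]; split. Qed.

Lemma blackburn_diag n t : blackburn (diag_array n t).
Proof.
move=> i1 i2 j1 j2 s neq /diag_arrayP[e1 _] /diag_arrayP[e2 _].
by split; apply/diag_array_None => e; apply: neq; congruence.
Qed.

(* By [diag_array_None], compatibility with respect to I_n(t) for any t. *)
Definition diag_compatible n (P Q : array n n) : Prop :=
  forall i1 j1 i2 j2 s,
    P i1 j1 = Some s -> Q i2 j2 = Some s -> i1 <> j2 /\ i2 <> j1.

(** The induction invariant. The boolean [S s] is read as 0 or 1, so the last field encodes
    membership and multiplicity at once. The total is the size [n], though an integer may be shared
    unevenly between [P] and [Q]. *)
Record pda_twins n (z : nat) (S : pred int) (P Q : array n n) : Prop := {
  twins_blackburnl : blackburn P;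
  twins_blackburnr : blackburn Q;
  twins_compatible : diag_compatible P Q;
  twins_starsl : forall k, column_stars P k = z;
  twins_starsr : forall k, column_stars Q k = z;
  twins_occurrences :
    forall s, (occurrences P s + occurrences Q s = n * S s)%N }.

(** A single occurrence makes the total [n * S s] positive. *)
Lemma twins_mem n z S (P Q : array n n) i j s : pda_twins z S P Q ->
  P i j = Some s \/ Q i j = Some s -> S s.
Proof.
move=> tw occ; have := twins_occurrences tw s.
suff: (0 < occurrences P s + occurrences Q s)%N.
  by case: (S s) => //; rewrite muln0 => /[swap] ->.
rewrite addn_gt0; apply/orP.
by case: occ => ?; [left|right]; apply/occurrences_gt0P; exists i, j.
Qed.

Lemma twins_cast m n (e : m = n) z S (P Q : array m m) : pda_twins z S P Q ->
  pda_twins z S (castmx (e, e) P) (castmx (e, e) Q).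
Proof. by case: n / e; rewrite !castmx_id. Qed.

Lemma twins_eq n z z' S S' (P Q : array n n) : z = z' -> S =1 S' ->
  pda_twins z S P Q -> pda_twins z' S' P Q.
Proof. by move=> <- eqS [*]; split => // s; rewrite -eqS. Qed.

(** Compatibility is vacuous here, as the two cells share no integer. *)
Lemma twins_diag1 (a b : int) : a != b ->
  pda_twins 0 (pred2 a b) (diag_array 1 a) (diag_array 1 b).
Proof.
move=> neq_ab.
split; try exact: blackburn_diag; try exact: column_stars_diag.
  move=> i1 j1 i2 j2 s /diag_arrayP[_ ->] /diag_arrayP[_ eq_ab].
  by rewrite eq_ab eqxx in neq_ab.
move=> s; rewrite !occurrences_diag /= !mul1n.
by case: eqP => [->|]; rewrite ?(negbTE neq_ab).
Qed.

Lemma twins_disjoint_diag n z S (P Q : array n n) c :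
  pda_twins z S P Q -> ~~ S c ->
  disjoint_entries P (diag_array n c) /\ disjoint_entries Q (diag_array n c).
Proof.
move=> tw /negP cNS; split=> i1 j1 i2 j2 s e /diag_arrayP[_ eq_s];
apply: cNS; rewrite -eq_s; apply: (twins_mem (i := i1) (j := j1) tw);
by [left|right].
Qed.

Lemma disjoint_diag n a b : a != b ->
  disjoint_entries (diag_array n a) (diag_array n b).
Proof.
move=> /eqP neq_ab i1 j1 i2 j2 s /diag_arrayP[_ ->] /diag_arrayP[_ eq_ab].
exact: neq_ab.
Qed.

(** * Twins in opposite corners: the recursion step and the lifting *)

(** Cross cells of a common entry of [P] and [Q] fall in the diagonal blocks, on stars by
    compatibility; the two diagonals have no common integer. *)
Lemma blackburn_twins_antidiag n z S (P Q : array n n) a b :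
  pda_twins z S P Q -> a != b -> ~~ S a -> ~~ S b ->
  blackburn (block_mx (diag_array n a) P Q (diag_array n b)).
Proof.
move=> tw neq_ab aNS bNS.
have [dPa dQa] := twins_disjoint_diag tw aNS.
have [dPb dQb] := twins_disjoint_diag tw bNS.
apply: blackburn_block; try exact: blackburn_diag;
  try exact: disjoint_entries_sym.
- exact: twins_blackburnl tw.
- exact: twins_blackburnr tw.
- by move=> i1 j1 i2 j2 s ea /(disjoint_diag neq_ab ea).
- move=> i1 j1 i2 j2 s eP eQ; have := twins_compatible tw eP eQ.
  by move=> [ne1 ne2]; split; apply/diag_array_None.
Qed.

Lemma blackburn_twins_diag n z S (P Q : array n n) a b :
  pda_twins z S P Q -> a != b -> ~~ S a -> ~~ S b ->
  blackburn (block_mx P (diag_array n a) (diag_array n b) Q).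
Proof.
move=> tw neq_ab aNS bNS.
have [dPa dQa] := twins_disjoint_diag tw aNS.
have [dPb dQb] := twins_disjoint_diag tw bNS.
apply: blackburn_block => //; try exact: blackburn_diag.
- exact: twins_blackburnl tw.
- exact: twins_blackburnr tw.
- move=> i1 j1 i2 j2 s eP eQ; have := twins_compatible tw eP eQ.
  by move=> [ne1 ne2]; split; apply/diag_array_None.
- by move=> i1 j1 i2 j2 s ea /(disjoint_diag neq_ab ea).
Qed.

(** Exchanging [a] and [b] puts the two copies of each in opposite corners, so the cross cells have
    row and column in different halves. The same holds for [P] against its own copy, and for [Q].
    Only [P] against [Q] needs the compatibility of the twins. *)
Lemma diag_compatible_step n z S (P Q : array n n) a b :
  pda_twins z S P Q -> a != b -> ~~ S a -> ~~ S b ->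
  diag_compatible (block_mx (diag_array n a) P Q (diag_array n b))
                  (block_mx (diag_array n b) P Q (diag_array n a)).
Proof.
move=> tw neq_ab aNS bNS.
have [dPa dQa] := twins_disjoint_diag tw aNS.
have [dPb dQb] := twins_disjoint_diag tw bNS.
have dab := disjoint_diag (n := n) neq_ab.
have cPQ := twins_compatible tw.
move=> i1 j1 i2 j2 s.
rewrite -(splitK i1) -(splitK i2) -(splitK j1) -(splitK j2).
case: (split i1) => {}i1; case: (split j1) => {}j1;
case: (split i2) => {}i2; case: (split j2) => {}j2 /=;
rewrite ?block_mxEul ?block_mxEur ?block_mxEdl ?block_mxEdr => e1 e2;
try by [case: (dPa _ _ _ _ _ e1 e2)|case: (dPa _ _ _ _ _ e2 e1)
    |case: (dPb _ _ _ _ _ e1 e2)|case: (dPb _ _ _ _ _ e2 e1)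
    |case: (dQa _ _ _ _ _ e1 e2)|case: (dQa _ _ _ _ _ e2 e1)
    |case: (dQb _ _ _ _ _ e1 e2)|case: (dQb _ _ _ _ _ e2 e1)
    |case: (dab _ _ _ _ _ e1 e2)|case: (dab _ _ _ _ _ e2 e1)
    |split=> /eqP; rewrite ?eq_lrshift ?eq_rlshift].
- have [ne1 ne2] := cPQ _ _ _ _ _ e1 e2.
  by split=> /eqP; rewrite ?eq_lshift ?eq_rshift => /eqP.
- have [ne1 ne2] := cPQ _ _ _ _ _ e2 e1.
  by split=> /eqP; rewrite ?eq_lshift ?eq_rshift => /eqP.
Qed.

(** All totals become [n + n]: each new array contains both [P] and [Q], hence [n] copies of every
    integer of [S], and one full diagonal of [a] and one of [b]. *)
Lemma twins_step n z S (P Q : array n n) a b :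
  pda_twins z S P Q -> a != b -> ~~ S a -> ~~ S b ->
  pda_twins (n.-1 + z) [predU pred2 a b & S]
    (block_mx (diag_array n a) P Q (diag_array n b))
    (block_mx (diag_array n b) P Q (diag_array n a)).
Proof.
move=> tw neq_ab aNS bNS; have neq_ba : b != a by rewrite eq_sym.
have starsP := twins_starsl tw; have starsQ := twins_starsr tw.
split.
- exact: blackburn_twins_antidiag tw _ _ _.
- exact: blackburn_twins_antidiag tw _ _ _.
- exact: diag_compatible_step tw _ _ _.
- by apply: column_stars_block => k;
    rewrite column_stars_diag ?starsP ?starsQ // addnC.
- by apply: column_stars_block => k;
    rewrite column_stars_diag ?starsP ?starsQ // addnC.
move=> s; rewrite !occurrences_block !occurrences_diag /=.
have := twins_occurrences tw s; rewrite /in_mem /=.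
have [->|] := eqVneq s a; first by rewrite (negbTE neq_ab) (negbTE aNS) /=; lia.
have [->|] := eqVneq s b; first by rewrite (negbTE bNS) /=; lia.
by case: (S s) => /=; lia.
Qed.

(** * The recursive arrays as twins *)

Definition interval (x : int) (n : nat) : pred int :=
  fun s => (x <= s < x + n%:Z)%R.

Lemma arrAS r x : arrA r.+2 x =
  block_array (diag_array (2 ^ r.+1) x) (arrA r.+1 (x + 2))
              (arrA' r.+1 (x + 2)) (diag_array (2 ^ r.+1) (x + 1)).
Proof. by []. Qed.

Lemma arrA'S r x : arrA' r.+2 x =
  block_array (diag_array (2 ^ r.+1) (x + 1)) (arrA r.+1 (x + 2))
              (arrA' r.+1 (x + 2)) (diag_array (2 ^ r.+1) x).
Proof. by []. Qed.

Lemma const_mx1 c : const_mx (Some c) = diag_array 1 c.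
Proof. by apply/matrixP=> i j; rewrite !mxE !ord1. Qed.

(* For r = 1 the twins one level below are the 1 x 1 arrays (x + 1), (x + 2). *)
Lemma twins_arrA r x :
  pda_twins (2 ^ r.+1 - r - 2) (interval x (2 * r + 4))
    (arrA r.+1 x) (arrA' r.+1 x).
Proof.
elim: r x => [|r IHr] x.
  rewrite /= /block_array !const_mx1.
  apply: twins_cast; apply: twins_eq; last first.
    by apply: twins_step; first apply: twins_diag1; rewrite /=; lia.
  - by move=> s; rewrite /interval /in_mem /=; lia.
  - by [].
rewrite arrAS arrA'S; apply: twins_cast; apply: twins_eq; last first.
  (* The new integers [x] and [x + 1] are fresh, lying just below the interval that starts at
     [x + 2]. *)
  by apply: twins_step (IHr (x + 2)) _ _ _; rewrite /interval; lia.
- by move=> s; rewrite /interval /in_mem /=; lia.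
(* This bound keeps the truncated subtractions in the star counts exact. *)
- have: (r < 2 ^ r)%N by rewrite ltn_expl.
  by rewrite !expnS; lia.
Qed.

(** The top left cell, read after undoing the cast, is [x] in the first array; in the second it is
    [x + 3] for size 2 and [x + 1] for larger sizes. *)
Lemma arrA_neq r x : arrA r.+1 x <> arrA' r.+1 x.
Proof.
have pos : (0 < 2 ^ r)%N by rewrite expn_gt0.
set i : 'I_(2 ^ r + 2 ^ r) := lshift _ (Ordinal pos).
pose e := esym (expn2_double r).
move=> /(congr1 (fun B => castmx (e, e) B i i)); rewrite {}/e.
by case: r pos @i => [|r] pos i; rewrite ?arrAS ?arrA'S /= /block_array !castmxK
  !block_mxEul !mxE ?eqxx => -[]; lia.
Qed.

(** * From counts to PDAs, and the lifting *)

Lemma in_entries f K (P : array f K) s :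
  (s \in entries P) = (0 < occurrences P s)%N.
Proof.
rewrite /entries inE /= mem_pmap; apply/mapP/occurrences_gt0P.
  by move=> [[j k] _ /esym Pjk]; exists j, k.
by move=> [j [k Pjk]]; exists (j, k); rewrite ?mem_enum.
Qed.

Lemma is_pda_column_stars f K (P : array f K) z : (0 < K)%N -> (0 < f)%N ->
  blackburn P -> (forall k, column_stars P k = z) -> is_pda P.
Proof.
move=> K_gt0 f_gt0 bP starsP; exists z, (entries P); split=> //.
- by move=> j k s Pjk; rewrite in_entries; apply/occurrences_gt0P; exists j, k.
- by move=> k; rewrite card_column_stars.
- by move=> s; rewrite in_entries => /occurrences_gt0P.
Qed.

(** As [g] is positive, the counts also determine [S]: its members are exactly the integers that
    occur. *)
Lemma regular_pda_occurrences g K f z (S : {fset int}) (P : array f K) :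
  (0 < g)%N -> (0 < K)%N -> (0 < f)%N -> blackburn P ->
  (forall k, column_stars P k = z) ->
  (forall s, occurrences P s = g * (s \in S))%N ->
  regular_pda g K f z #|` S| P.
Proof.
move=> g_gt0 K_gt0 f_gt0 bP starsP occP.
have occE s : (s \in S) = (0 < occurrences P s)%N.
  by rewrite occP muln_gt0 g_gt0 lt0b.
exists S; split=> //; last by move=> s sS; rewrite card_occurrences occP sS muln1.
split=> //.
- by move=> j k s Pjk; rewrite occE; apply/occurrences_gt0P; exists j, k.
- by move=> k; rewrite card_column_stars.
- by move=> s; rewrite occE => /occurrences_gt0P.
Qed.

Lemma regular_pda_cast g m n (e : m = n) z c (P : array m m) :
  regular_pda g m m z c P -> regular_pda g n n z c (castmx (e, e) P).
Proof. by case: n / e; rewrite castmx_id. Qed.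

Lemma card_interval x n (S : {fset int}) :
  (forall s, s \in S = interval x n s) -> #|` S| = n.
Proof.
move=> inS; have -> : S = [fset s in [seq (x + k%:Z)%R | k <- iota 0 n]]%fset.
  apply/fsetP=> s; rewrite inS inE /interval /=; apply/idP/mapP.
    by move=> ?; exists `|s - x|%N; rewrite ?mem_iota; lia.
  by move=> [k]; rewrite mem_iota => ? ->; lia.
rewrite card_fseq undup_id ?size_map ?size_iota // map_inj_uniq ?iota_uniq //.
by move=> k l; lia.
Qed.

Unset Implicit Arguments.

Theorem lemma24 (r : nat) (hr : (1 <= r)%N) (x : int) :
  let A := arrA r x in
  let A' := arrA' r x in
  let S : {fset int} := (entries A `|` entries A')%fset in
  forall t : int, t \notin S ->
    [/\ A <> A', is_pda A, is_pda A',
        blackburn_compatible A A' (diag_array (2 ^ r) t)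
      & forall t1 t2 : int, t1 <> t2 -> t1 \notin S -> t2 \notin S ->
          regular_pda (2 ^ r) (2 ^ r.+1) (2 ^ r.+1)
            (2 ^ r.+1 - r - 2) (2 * r + 4)
            (lifting_I2 A A' t1 t2)].
Proof.
case: r hr => [//|r] _ A A' S t _.
have tw : pda_twins _ _ A A' := twins_arrA r x.
have starsA := twins_starsl tw; have starsA' := twins_starsr tw.
have n_gt0 : (0 < 2 ^ r.+1)%N by rewrite expn_gt0.
(* The exponent is now [r.+1], so the interval has length [2 * r.+1 + 2]. *)
have inS s : (s \in S) = interval x (2 * r + 4) s.
  rewrite inE !in_entries -addn_gt0 (twins_occurrences tw).
  by rewrite muln_gt0 n_gt0 lt0b.
split.
- exact: arrA_neq.
- exact: is_pda_column_stars (twins_blackburnl tw) starsA.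
- exact: is_pda_column_stars (twins_blackburnr tw) starsA'.
- move=> i1 i2 j1 j2 s eA eA'.
  have [ne1 ne2] := twins_compatible tw eA eA'.
  by split; apply/diag_array_None.
move=> t1 t2 /eqP neq_t t1NS t2NS; apply: regular_pda_cast.
(* The integers of the lifting: those of the twins and the two fresh diagonal ones. *)
pose T := (t1 |` (t2 |` S))%fset.
have -> : (2 * r.+1 + 4)%N = #|` T|.
  rewrite !cardfsU1 in_fset1U negb_or neq_t t1NS t2NS (card_interval inS).
  by lia.
apply: regular_pda_occurrences; rewrite ?addn_gt0 ?n_gt0 //.
- by apply: blackburn_twins_diag tw _ _ _ => //; rewrite -inS.
(* Each column crosses one twin and one diagonal block, which adds [2 ^ r.+1 - 1] stars. *)
- by apply: column_stars_block => k; rewrite column_stars_diag ?starsA ?starsA';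
    have := ltn_expl r (isT : 1 < 2)%N; rewrite !expnS; lia.
move=> s; rewrite occurrences_block !occurrences_diag !in_fset1U.
(* Regularity: the twins contribute [2 ^ r.+1] copies of each integer of [S] in total, and [t1] and
   [t2] fill one diagonal of that length each. *)
have := twins_occurrences tw s; rewrite -inS.
have [->|_] := eqVneq s t1; first by rewrite (negbTE neq_t) (negbTE t1NS) /=; lia.
have [->|_] := eqVneq s t2; first by rewrite (negbTE t2NS) /=; lia.
by case: (s \in S); lia.
Qed.
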